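(* Let $a,b,n$ be positive integers and let $$a'=\left\lfloor \frac{a(n-1)}{n}\right\rfloor.$$ Suppose that $b\leq a'$. If $H=(V,E)$ is an $n$-uniform hypergraph with $$|E(H)|\leq \left(\frac{a'}{b}\right)^n,$$ then $H$ is $(a:b)$-colorable.
   Context: A hypergraph is a pair $H=(V,E)$, where $V$ is the set of vertices and $E=E(H)$ is a family of subsets of $V$, called edges. It is $n$-uniform if every edge contains exactly $n$ vertices. An $(a:b)$-coloring of $H$ assigns to each vertex $v\in V$ a set of exactly $b$ distinct colors from $[a]=\{1,\ldots,a\}$, i.e. it is a map $\chi:V\to\binom{[a]}{b}$. An edge $A\in E$ is properly colored if no single color is shared by all vertices of $A$, i.e. $\bigcap_{v\in A}\chi(v)=\varnothing$. The hypergraph $H$ is $(a:b)$-colorable if there is such a map $\chi$ under which every edge is properly colored. *)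

(* Defs.v *)
From mathcomp Require Import all_boot all_order all_algebra.
From mathcomp Require Import finmap.
From mathcomp Require Import boolp classical_sets functions cardinality.

Set Implicit Arguments.
Unset Strict Implicit.
Unset Printing Implicit Defensive.

Local Open Scope classical_set_scope.
Local Open Scope card_scope.

Record hypergraph := Hypergraph {
  vertex : Type;
  edges : set (set vertex) }.

Arguments edges : clear implicits.

Definition uniform (n : nat) (H : hypergraph) : Prop :=
  forall A, edges H A -> A #= `I_n.

(* The palette [a] is represented by 'I_a = {0, ..., a - 1}. *)
Definition is_coloring (a b : nat) (H : hypergraph)
    (chi : vertex H -> {set 'I_a}) : Prop :=
  forall v, #|chi v| = b.

Definition properly_colored (a : nat) (H : hypergraph)
    (chi : vertex H -> {set 'I_a}) (A : set (vertex H)) : Prop :=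
  \bigcap_(v in A) [set` chi v] = set0.

Definition colorable (a b : nat) (H : hypergraph) : Prop :=
  exists2 chi : vertex H -> {set 'I_a},
    is_coloring b chi & forall A, edges H A -> properly_colored chi A.

(* fset_set sends infinite sets to the empty fset, so the cardinality bound is
   meaningful only together with finiteness of the edge family. *)
Definition edge_card_le (H : hypergraph) (q : rat) : Prop :=
  finite_set (edges H) /\ (#|` fset_set (edges H)|%:R <= q)%R.

(* Main.v *)
Require Import Defs.
From mathcomp Require Import all_boot all_order all_algebra.
From mathcomp Require Import finmap.
From mathcomp Require Import boolp classical_sets functions cardinality.

Set Implicit Arguments.
Unset Strict Implicit.
Unset Printing Implicit Defensive.

(** Split the palette into a' main colors and k = a - a' spare ones; the floor
    makes a' <= k (n - 1).

    If every vertex receives a uniformly random b-subset of the main colors, a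
    given edge has a given main color in common with probability (b / a')^n, so
    the expected number of bad pairs (edge, color shared by the whole edge) is
    at most |E| a' (b / a')^n <= a'.  Some main coloring thus has at most a' bad
    pairs ([few_bad_pairs]).

    Each bad pair (A, c) is repaired by trading c for a spare color at one
    vertex of A.  The trades at one vertex need distinct spare colors, so at
    most k of them may happen there; since an edge offers n k slots and at most
    a' <= k (n - 1) are ever taken, a greedy choice of vertices respects this
    ([greedy_choice]).  Listing the trades vertex by vertex and handing out the
    k spare colors cyclically gives distinct spare colors at each vertex and
    uses each spare color at most n - 1 times ([equitable_relabel]), too few to
    cover an edge.  Hence neither a main nor a spare color is shared by a whole
    edge ([finite_family_colorable]).

    The vertex set may be infinite, but only the finitely many vertices lying
    on edges matter ([uniform_trace_on_finite_set]). *)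

(** * Main colors: averaging over all colorings *)

Lemma card_draws_mem (T : finType) (c : T) (b : nat) :
  #|[set B : {set T} | (#|B| == b.+1) && (c \in B)]| = 'C(#|T|.-1, b).
Proof.
have := cardsID [set B : {set T} | c \in B] [set B : {set T} | #|B| == b.+1].
rewrite card_draws.
have -> : [set B : {set T} | #|B| == b.+1] :\: [set B : {set T} | c \in B]
        = [set B : {set T} | B \subset [set~ c] & #|B| == b.+1].
  by apply/setP => B; rewrite !inE finset.subsetC finset.sub1set inE.
rewrite cards_draws cardsC1.
have {2}-> : #|T| = #|T|.-1.+1 by rewrite prednK //; apply/card_gt0P; exists c.
rewrite binS addnC => /addnI <-; apply: eq_card => B.
by rewrite !inE.
Qed.

(** The probability (b / #|C|)^#|A| that a random coloring by b-subsets has c in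
    common on A, with denominators cleared: each vertex of A contributes
    'C(#|C| - 1, b - 1) choices out of 'C(#|C|, b).  The size of the subsets is
    written b + 1, which makes that first binomial subtraction-free. *)
Lemma card_family_mem (V C : finType) (b : nat) (A : {set V}) (c : C) :
  #|[set f : {ffun V -> {set C}} |
      [forall v, #|f v| == b.+1] & [forall v in A, c \in f v]]| * #|C| ^ #|A|
  = b.+1 ^ #|A| * 'C(#|C|, b.+1) ^ #|V|.
Proof.
pose F v := [set B : {set C} | (#|B| == b.+1) && ((v \in A) ==> (c \in B))].
have -> : #|[set f : {ffun V -> {set C}} |
      [forall v, #|f v| == b.+1] & [forall v in A, c \in f v]]|
    = #|family (fun v => mem (F v))|.
  apply: eq_card => f; rewrite !inE; apply/andP/forallP.
    by case=> /forallP h1 /forallP h2 v; rewrite inE h1 h2.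
  by move=> h; split; apply/forallP => v; have := h v; rewrite inE => /andP[].
have FE v : #|F v| = if v \in A then 'C(#|C|.-1, b) else 'C(#|C|, b.+1).
  rewrite /F; case: (v \in A) => /=; first exact: card_draws_mem.
  by rewrite -card_draws; apply: eq_card => B; rewrite !inE andbT.
rewrite card_family foldrE big_map big_enum /=.
under eq_bigr => v _ do rewrite FE.
rewrite (bigID (mem A)) /=.
rewrite (eq_bigr (fun=> 'C(#|C|.-1, b))); last by move=> v ->.
rewrite [X in _ * X * _](eq_bigr (fun=> 'C(#|C|, b.+1))); last first.
  by move=> v /negbTE ->.
rewrite !prod_nat_const -(cardC A) expnD mulnA -!expnMn -mul_bin_diag.
by rewrite mulnAC -expnMn (mulnC #|C|).
Qed.

(** First moment: if every coloring had more than #|C| bad pairs, double counting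
    the triples (coloring, edge, shared color) would contradict the exact count
    of [card_family_mem]. *)
Lemma few_bad_pairs (V I C : finType) (E : I -> {set V}) (b n : nat) :
  0 < b <= #|C| -> (forall i, #|E i| = n) -> #|I| * b ^ n <= #|C| ^ n ->
  exists2 chi : V -> {set C}, (forall v, #|chi v| = b)
    & #|[set p : I * C | [forall v in E p.1, p.2 \in chi v]]| <= #|C|.
Proof.
case: b => // b /= le_bC sizeE leI.
pose F := [set f : {ffun V -> {set C}} | [forall v, #|f v| == b.+1]].
pose bad (f : {ffun V -> {set C}}) :=
  [set p : I * C | [forall v in E p.1, p.2 \in f v]].
have cardF : #|F| = 'C(#|C|, b.+1) ^ #|V|.
  rewrite -card_draws -card_ffun_on; apply: eq_card => f; rewrite !inE.
  by apply: eq_forallb => v; rewrite inE.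
have sum_bad : (\sum_(f in F) #|bad f|) * #|C| ^ n
             = #|I| * #|C| * (b.+1 ^ n * #|F|).
  transitivity (\sum_(p : I * C) b.+1 ^ n * #|F|); last first.
    by rewrite sum_nat_const card_prod.
  under eq_bigr => f _ do rewrite -sum1_card.
  rewrite (exchange_big_dep predT) //= big_distrl /=.
  apply: eq_bigr => -[i c] _; rewrite cardF -(sizeE i).
  rewrite -(card_family_mem b (E i) c) sum1_card; congr (_ * _).
  by apply: eq_card => f; rewrite unfold_in /= !inE.
suff [f] : exists2 f, f \in F & #|bad f| <= #|C|.
  by rewrite inE => /forallP fb badf; exists f => // v; apply/eqP.
apply/exists_inP; apply: contraT; rewrite negb_exists => /forallP all_bad.
have : #|F| * #|C|.+1 <= \sum_(f in F) #|bad f|.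
  rewrite -sum_nat_const; apply: leq_sum => f fF.
  by have := all_bad f; rewrite fF -ltnNge.
have C_gt0 : 0 < #|C| by apply: leq_trans le_bC.
have F_gt0 : 0 < #|F| by rewrite cardF expn_gt0 bin_gt0 le_bC.
have Cn_gt0 : 0 < #|C| ^ n by rewrite expn_gt0 C_gt0.
rewrite -(leq_pmul2r Cn_gt0) sum_bad leqNgt => /negP[].
rewrite mulnACA; apply: leq_ltn_trans (leq_mul leI (leqnn _)) _.
by rewrite mulnC (mulnC #|C|) ltn_pmul2r // ltn_pmul2l.
Qed.

(** * Spare colors: choosing and labelling the trades *)

(** A pair (v, c) in S means that v gives up c.  If all the vertices of A had
    already given up k colors, then S would have at least k #|A| >= k m elements,
    whereas fewer than k m trades precede the current pair; so some vertex of A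
    always has room.  Bad pairs may share a trade, which is why S is
    a set and not a list indexed by ps. *)
Lemma greedy_choice (V C : finType) (k m : nat) (ps : seq ({set V} * C)) :
  size ps <= k * m -> (forall p, p \in ps -> m < #|p.1|) ->
  exists S : {set V * C},
    [/\ #|S| <= size ps,
        forall v, #|[set p in S | p.1 == v]| <= k
      & forall p, p \in ps -> exists2 v, v \in p.1 & (v, p.2) \in S].
Proof.
elim: ps => [|[A c] ps IH] /= szps big_ps.
  exists finset.set0; split=> // [|v]; first by rewrite cards0.
  by rewrite eq_card0 // => p; rewrite !inE.
have {IH}[||S [cardS loadS hitS]] := IH.
- exact: ltnW.
- by move=> p pps; apply: big_ps; rewrite inE pps orbT.
have [v vA loadv] : exists2 v, v \in A & #|[set p in S | p.1 == v]| < k.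
  apply/exists_inP; apply: contraT; rewrite negb_exists => /forallP full.
  have : k * #|A| <= #|S|.
    have -> : #|S| = \sum_v #|[set p in S | p.1 == v]|.
      rewrite -sum1_card (partition_big fst predT) //=.
      apply: eq_bigr => v _; rewrite -sum1_card.
      by apply: eq_bigl => p; rewrite inE.
    rewrite mulnC -sum_nat_const [X in _ <= X](bigID (mem A)) /=.
    apply: leq_trans (leq_addr _ _); apply: leq_sum => v vA.
    by have := full v; rewrite vA -leqNgt.
  rewrite leqNgt => /negP[]; apply: leq_ltn_trans cardS _.
  apply: leq_trans szps _; rewrite leq_mul2l.
  by rewrite (ltnW (big_ps (A, c) _)) ?orbT // inE eqxx.
exists ((v, c) |: S); split.
- by rewrite cardsU1; apply: leq_trans (leq_add (leq_b1 _) cardS).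
- move=> w; have [->|wv] := eqVneq w v.
    apply: leq_trans loadv; rewrite -add1n.
    have := leq_b1 ((v, c) \notin [set p in S | p.1 == v]).
    rewrite -(leq_add2r #|[set p in S | p.1 == v]|) -cardsU1.
    apply: leq_trans; apply: subset_leq_card; apply/fintype.subsetP => p.
    by rewrite !inE; case: eqP => //= ->.
  apply: leq_trans (loadS w); apply: subset_leq_card; apply/fintype.subsetP => p.
  rewrite !inE; case: eqP => //= -> /=.
  by rewrite eq_sym (negbTE wv).
- move=> p; rewrite inE => /orP[/eqP->|/hitS[w wp wS]].
    by exists v; rewrite // !inE eqxx.
  by exists w; rewrite // !inE wS orbT.
Qed.

(** Rank the elements of S lexicographically, vertex first, and label them by their
    rank modulo k.  The elements at one vertex have consecutive ranks and there
    are at most k of them, so their labels differ; elements with the same label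
    have distinct quotients rank / k, all smaller than m. *)
Lemma equitable_relabel (V C : finType) (k m : nat) (S : {set V * C}) :
  0 < k -> #|S| <= k * m -> (forall v, #|[set p in S | p.1 == v]| <= k) ->
  exists g : V * C -> 'I_k,
    (forall p q, p \in S -> q \in S -> p.1 = q.1 -> g p = g q -> p = q)
    /\ forall j, #|[set p in S | g p == j]| <= m.
Proof.
move=> k_gt0 cardS loadS.
(* An injective integer code of the lexicographic order. *)
pose key (p : V * C) := enum_rank p.1 * #|C| + enum_rank p.2.
have key_lt p q : enum_rank p.1 < enum_rank q.1 -> key p < key q.
  move=> lt; apply: leq_trans (leq_addr _ _).
  apply: leq_trans (_ : (enum_rank p.1).+1 * #|C| <= _); last first.
    by rewrite leq_mul2r lt orbT.
  by rewrite mulSnr ltn_add2l.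
have key_inj : injective key.
  move=> [v c] [w d] eq_key; case: (ltngtP (enum_rank v) (enum_rank w)) => lt.
  - by have := key_lt (v, c) (w, d) lt; rewrite eq_key ltnn.
  - by have := key_lt (w, d) (v, c) lt; rewrite eq_key ltnn.
  move: eq_key; rewrite /key /= lt => /addnI/ord_inj/enum_rank_inj ->.
  by rewrite (enum_rank_inj (ord_inj lt)).
pose rk p := #|[set q in S | key q < key p]|.
have rkD p q : p \in S -> key p < key q ->
    rk p + #|[set r in S | key p <= key r < key q]| = rk q.
  move=> pS lt; rewrite /rk -[RHS](cardsID [set r | key r < key p]).
  congr (_ + _); apply: eq_card => r; rewrite !inE.
    by case: (ltnP (key r) (key p)) => [/ltn_trans->|]; rewrite ?andbT ?andbF.
  by rewrite -leqNgt; case: (r \in S); rewrite /= ?andbT ?andbF.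
have rk_lt p q : p \in S -> key p < key q -> rk p < rk q.
  move=> pS lt; rewrite -(rkD p q) // -addn1 leq_add2l.
  by apply/card_gt0P; exists p; rewrite !inE pS leqnn.
have rk_inj : {in S &, injective rk}.
  move=> p q pS qS eq_rk; apply: key_inj; case: (ltngtP (key p) (key q)) => // lt.
    by have := rk_lt p q pS lt; rewrite eq_rk ltnn.
  by have := rk_lt q p qS lt; rewrite eq_rk ltnn.
have rk_bound p : p \in S -> rk p < #|S|.
  move=> pS; apply: proper_card; apply/properP; split.
    by apply/fintype.subsetP => q; rewrite inE => /andP[].
  by exists p; rewrite // inE ltnn andbF.
have rk_near p q : p \in S -> q \in S -> p.1 = q.1 -> key p < key q ->
    rk q - rk p < k.
  move=> pS qS eq1 lt; rewrite -(rkD p q) // addKn.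
  apply: leq_trans (loadS q.1); apply: proper_card; apply/properP; split.
    apply/fintype.subsetP => r; rewrite !inE => /and3P[-> /= ge_p lt_q].
    suff /enum_rank_inj->: enum_rank r.1 = enum_rank q.1 by [].
    apply: ord_inj; case: (ltngtP (enum_rank r.1) (enum_rank q.1)) => // lt1.
      by have := key_lt r p; rewrite eq1 => /(_ lt1); rewrite ltnNge ge_p.
    by move: (key_lt q r lt1); rewrite ltnNge (ltnW lt_q).
  by exists q; rewrite !inE ?qS ?eqxx // ltnn !andbF.
exists (fun p => Ordinal (ltn_pmod (rk p) k_gt0)); split.
  suff H p q : p \in S -> q \in S -> p.1 = q.1 -> key p < key q ->
      rk p %% k <> rk q %% k.
    move=> p q pS qS eq1 [] eq_mod; apply: key_inj.
    by case: (ltngtP (key p) (key q)) => // lt; [case: (H p q) | case: (H q p)].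
  move=> pS qS eq1 lt /eqP; rewrite eq_sym eqn_mod_dvd; last first.
    exact/ltnW/rk_lt.
  move=> /dvdn_leq; rewrite subn_gt0 rk_lt // => /(_ isT).
  by rewrite leqNgt rk_near.
move=> j; rewrite cardE -(size_map (fun p => rk p %/ k)) -[m](size_iota 0).
apply: uniq_leq_size => [|i /mapP[p]].
  rewrite map_inj_in_uniq ?enum_uniq // => p q.
  rewrite !mem_enum !inE => /andP[pS /eqP jp] /andP[qS /eqP jq] eq_div.
  apply: rk_inj => //; rewrite (divn_eq (rk p) k) (divn_eq (rk q) k) eq_div.
  by move: jp jq => <- [->].
rewrite mem_enum inE => /andP[pS _] ->; rewrite mem_iota /= add0n.
by rewrite ltn_divLR // mulnC (leq_trans (rk_bound p pS)).
Qed.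

(** * Combining both palettes *)

(** The main colors are the left summand of 'I_(a' + k), the spare ones the right
    summand.  Indexing the edges by I instead of taking a set of edges spares any
    injectivity argument when the edges are restricted to finitely many
    vertices. *)
Lemma finite_family_colorable (V I : finType) (E : I -> {set V})
    (a' k b n : nat) :
  0 < b <= a' -> 0 < n -> a' <= k * n.-1 -> (forall i, #|E i| = n) ->
  #|I| * b ^ n <= a' ^ n ->
  exists2 chi : V -> {set 'I_(a' + k)}, (forall v, #|chi v| = b)
    & forall i x, ~ {in E i, forall v, x \in chi v}.
Proof.
move=> ba n_gt0 le_a' sizeE leI.
have k_gt0 : 0 < k.
  by case: k le_a' => //; case/andP: ba => /leq_trans h /h; case: (a').
have [| |chi0 cardchi0] := @few_bad_pairs V I 'I_a' E b n _ sizeE.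
- by rewrite card_ord.
- by rewrite card_ord.
rewrite card_ord; set P := [set p | _] => cardP.
have [| |S0 [cardS0 loadS0 hitS0]] :=
    @greedy_choice V 'I_a' k n.-1 [seq (E p.1, p.2) | p <- enum P].
- by rewrite size_map -cardE (leq_trans cardP).
- by move=> _ /mapP[p _ ->] /=; rewrite sizeE prednK.
(* Trades of a color that the vertex does not have are meaningless: drop them. *)
pose S := [set p in S0 | p.2 \in chi0 p.1].
have sSS0 : S \subset S0 by apply/fintype.subsetP => p; rewrite inE => /andP[].
have [||g [g_inj g_few]] := @equitable_relabel V 'I_a' k n.-1 S k_gt0.
- apply: leq_trans (subset_leq_card sSS0) _; apply: leq_trans cardS0 _.
  by rewrite size_map -cardE (leq_trans cardP).
- move=> v; apply: leq_trans (loadS0 v); apply: subset_leq_card.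
  by apply/fintype.subsetP => p; rewrite !inE -andbA => /and3P[-> _ ->].
pose out v := [set c in chi0 v | (v, c) \in S].
pose chi v := [set lshift k c | c in chi0 v :\: out v]
          :|: [set rshift a' (g (v, c)) | c in out v].
exists chi => [v|i x all_x].
  have sout : out v \subset chi0 v.
    by apply/fintype.subsetP => c; rewrite inE => /andP[].
  rewrite cardsU disjoint_setI0 ?cards0 ?subn0; last first.
    apply/pred0P => x /=; apply/negP => /andP[/imsetP[c _ ->]].
    by case/imsetP => d _ /eqP; rewrite eq_lrshift.
  rewrite (card_imset _ (@lshift_inj _ _)) card_in_imset; last first.
    move=> c d; rewrite [c \in _]inE [d \in _]inE => /andP[_ cS] /andP[_ dS].
    by move=> /rshift_inj /(g_inj (v, c) (v, d) cS dS erefl)[].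
  rewrite cardsD (finset.setIidPr sout) subnK ?cardchi0 //.
  by rewrite -(cardchi0 v) subset_leq_card.
(* A shared main color was shared before the trades, hence was given up
   somewhere; a shared spare color would be used at n vertices. *)
case: (split_ordP x) all_x => [c ->|j ->] all_x.
  have keep v : v \in E i -> c \in chi0 v :\: out v.
    move=> /all_x; rewrite inE => /orP[/imsetP[d dD /lshift_inj->] //|].
    by case/imsetP => d _ /eqP; rewrite eq_lrshift.
  have [|v vE vS] := hitS0 (E i, c).
    apply/mapP; exists (i, c) => //; rewrite mem_enum inE.
    by apply/forall_inP => v /keep; rewrite inE => /andP[].
  by have := keep v vE; rewrite !inE vS /=; case: (c \in chi0 v).
have : n <= #|[set p in S | g p == j]|; last first.
  by rewrite leqNgt (leq_ltn_trans (g_few j)) // prednK.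
rewrite -(sizeE i); apply: leq_trans (leq_imset_card fst _).
apply: subset_leq_card; apply/fintype.subsetP => v /all_x; rewrite inE.
case/orP => /imsetP[c].
  by move=> _ /eqP; rewrite eq_rlshift.
rewrite inE => /andP[_ vcS] /rshift_inj ->.
by apply/imsetP; exists (v, c); rewrite // inE vcS eqxx.
Qed.

(** * From arbitrary hypergraphs to finite families *)

Lemma edge_bound_nat (e a' b n : nat) :
  0 < b -> (e%:R <= (a'%:R / b%:R) ^+ n :> rat)%R -> e * b ^ n <= a' ^ n.
Proof.
move=> b_gt0; rewrite GRing.exprMn GRing.exprVn Num.Theory.ler_pdivlMr; last first.
  by rewrite Num.Theory.exprn_gt0 // Num.Theory.ltr0n.
by rewrite -!GRing.natrX -GRing.natrM Num.Theory.ler_nat.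
Qed.

(** The k = a - a' spare colors, each usable n - 1 times, suffice for a' trades:
    a' n <= a (n - 1) = (a' + k) (n - 1), and a' (n - 1) cancels. *)
Lemma floor_le_spare_slots (a n : nat) (a' := (a * (n - 1)) %/ n) : 0 < n ->
  a' <= a /\ a' <= (a - a') * n.-1.
Proof.
move=> n_gt0.
have le_mul : a' * n <= a * n.-1 by rewrite -subn1 leq_trunc_div.
have le_a : a' <= a.
  by rewrite -(leq_pmul2r n_gt0) (leq_trans le_mul) // leq_mul2l leq_pred orbT.
split=> //; rewrite mulnBl leq_subRL ?leq_mul2r ?le_a ?orbT //.
by rewrite addnC -mulnS prednK.
Qed.

(** X is the union of the edges, so that intersecting an edge with X loses none of
    its n vertices. *)
Lemma uniform_trace_on_finite_set (H : hypergraph) (n : nat) :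
  finite_set (edges H) -> uniform n H ->
  exists X : {fset {classic vertex H}},
    forall A, edges H A -> #|[set x : X | `[< A (val x) >]]| = n.
Proof.
move=> fin_edges unif.
have fin_edge A : edges H A -> finite_set A.
  by move=> /unif An; apply/finite_setP; exists n.
have finU : finite_set (\bigcup_(A in edges H) A)%classic.
  exact: bigcup_finite.
pose X := fset_set (T := {classic vertex H}) (\bigcup_(A in edges H) A)%classic.
exists X => A AE.
have sAX v : A v -> v \in X.
  by move=> Av; rewrite (in_fset_set (T := {classic vertex H}) finU) inE; exists A.
rewrite -(card_fset_set (T := {classic vertex H}) (unif A AE)).
rewrite cardE -(size_map val); apply/perm_size/uniq_perm.
- by rewrite (map_inj_uniq val_inj) enum_uniq.
- exact: fset_uniq.
move=> v; rewrite (in_fset_set (T := {classic vertex H}) (fin_edge A AE)).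
apply/mapP/idP => [[x + ->]|]; rewrite ?inE.
  by rewrite mem_enum inE => /asboolP.
move=> Av; exists (FSetSub (sAX v Av)) => //.
by rewrite mem_enum inE; apply/asboolP.
Qed.

Theorem theorem3 (a b n : nat) (ha : 0 < a) (hb : 0 < b) (hn : 0 < n) :
  let a' := (a * (n - 1)) %/ n in
  b <= a' ->
  forall H : hypergraph,
    uniform n H ->
    edge_card_le H ((a'%:R / b%:R) ^+ n)%R ->
    colorable a b H.
Proof.
move=> a' le_ba' H unif [fin_edges /(edge_bound_nat hb) few_edges].
have [le_a'a le_a'] := floor_le_spare_slots a hn; rewrite -/a' in le_a'a le_a'.
have [X traceX] := uniform_trace_on_finite_set fin_edges unif.
pose I : finType := fset_set (edges H).
have edgeI (i : I) : edges H (val i).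
  by have := valP i; rewrite in_fset_set // inE.
pose E (i : I) := [set x : X | `[< val i (val x) >]].
have [|||chi chib proper_chi] :=
    @finite_family_colorable X I E a' (a - a') b n _ hn le_a'.
- by rewrite hb.
- by move=> i; apply: traceX.
- by rewrite -cardfE.
rewrite -(subnKC le_a'a).
(* Outside X any b-subset D will do: the vertices in X already make every edge
   properly colored. *)
have /card_gt0P[D] : 0 < #|[set D : {set 'I_(a' + (a - a'))} | #|D| == b]|.
  by rewrite card_draws card_ord bin_gt0 (leq_trans le_ba') // leq_addr.
rewrite inE => /eqP Db.
exists (fun v : {classic vertex H} => if insub v is Some x then chi x else D).
  by move=> v; case: insub.
move=> A AE.
rewrite /properly_colored -subset0 => c /= all_c.
have AI : A \in fset_set (edges H) by rewrite in_fset_set // inE.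
apply: (proper_chi (FSetSub AI) c) => x; rewrite inE => /asboolP /all_c /=.
by rewrite valK.
Qed.
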